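(* Let $H$ be a Hopf algebra over a field $k$ with antipode $S$, and let $A$ be a finite dimensional right $H$-comodule algebra. The following assertions hold. (1) If $A$ is right $H$-Frobenius, then $A$ is left $H$-Frobenius. (2) If the antipode $S$ is injective and $A$ is left $H$-Frobenius, then $A$ is also right $H$-Frobenius.
   Context: A right $H$-comodule algebra $A$ has coaction $a\mapsto\sum a_0\otimes a_1$ that is an algebra map $A\to A\otimes H$. For a right $H$-comodule algebra $R$, ${}_R\mathcal{M}^H$ (resp. $\mathcal{M}^H_R$) is the category of left (resp. right) $(R,H)$-Doi-Hopf modules: left (resp. right) $R$-modules $M$ that are right $H$-comodules with $\rho(rm)=\sum r_0m_0\otimes r_1m_1$ (resp. $\rho(mr)=\sum m_0r_0\otimes m_1r_1$); morphisms are $R$-linear $H$-colinear maps. $A^{(S^2)}$ denotes the right $H$-comodule algebra which equals $A$ as an algebra and has coaction $a\mapsto\sum a_0\otimes S^2(a_1)$. For $A$ finite dimensional, the dual space $A^*$ is a right $H$-comodule with coaction $f\mapsto\sum f_{0}\otimes f_{1}$ determined by $\sum f_{0}(x)f_{1}=\sum f(x_0)S(x_1)$ for all $x\in A$. With the right action $(fa)(x)=f(ax)$, $A^*$ is an object of $\mathcal{M}^H_A$; with the left action $(af)(x)=f(xa)$, $A^*$ is an object of ${}_{A^{(S^2)}}\mathcal{M}^H$. $A$ is called left $H$-Frobenius if $A^{(S^2)}\simeq A^*$ in ${}_{A^{(S^2)}}\mathcal{M}^H$, and right $H$-Frobenius if $A\simeq A^*$ in $\mathcal{M}^H_A$. 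*)

(* Defs.v *)
From HB Require Import structures.
From mathcomp Require Import all_boot all_order all_algebra all_field.
From mathcomp Require Import boolp.

Set Implicit Arguments.
Unset Strict Implicit.
Unset Printing Implicit Defensive.

Import GRing.Theory.
Local Open Scope ring_scope.
Local Open Scope quotient_scope.

Section TensorProduct.
Variables (k : fieldType) (U V : lmodType k).

Definition is_bilinear (W : lmodType k) (b : U -> V -> W) : Prop :=
  (forall v, linear (b^~ v)) /\ (forall u, linear (b u)).

(* A list of pairs stands for the sum of the corresponding pure tensors; two
   lists are identified when no bilinear map separates them, so that the
   universal property holds by construction. *)
Definition tensor_eqv (s t : seq (U * V)) : bool :=
  `[< forall (W : lmodType k) (b : U -> V -> W), is_bilinear b ->
        \sum_(p <- s) b p.1 p.2 = \sum_(p <- t) b p.1 p.2 >].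

Lemma tensor_eqv_equiv : equiv_class_of tensor_eqv.
Proof.
split=> [s|s t|t s r /asboolP st /asboolP tr].
- exact/asboolP.
- by apply/asbool_equiv_eq; split=> st W b bb; rewrite st.
- by apply/asboolP => W b bb; rewrite st // tr.
Qed.

Canonical tensor_eqv_rel := EquivRelPack tensor_eqv_equiv.

Definition tensor := {eq_quot tensor_eqv}.
HB.instance Definition _ := Choice.on tensor.

(* The map induced by b on the tensor product, when b is bilinear. In Sweedler
   notation for a comultiplication, [tlift b (D h)] is the sum of the
   b h_1 h_2. *)
Definition tlift (W : lmodType k) (b : U -> V -> W) (t : tensor) : W :=
  \sum_(p <- repr t) b p.1 p.2.

Lemma tliftE (W : lmodType k) (b : U -> V -> W) s : is_bilinear b ->
  tlift b (\pi_tensor s) = \sum_(p <- s) b p.1 p.2.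
Proof.
move=> bb; have /eqmodP/asboolP := reprK (\pi_tensor s).
exact.
Qed.

Lemma tensorP (x y : tensor) :
  (forall (W : lmodType k) (b : U -> V -> W), is_bilinear b ->
     tlift b x = tlift b y) -> x = y.
Proof.
move=> xy; rewrite -[x]reprK -[y]reprK; apply/eqmodP/asboolP => W b bb.
exact: xy.
Qed.

Definition tens (u : U) (v : V) : tensor := \pi_tensor [:: (u, v)].
Definition tensor_zero : tensor := \pi_tensor [::].
Definition tensor_add (x y : tensor) : tensor := \pi_tensor (repr x ++ repr y).
Definition tensor_scale (c : k) (x : tensor) : tensor :=
  \pi_tensor [seq (c *: p.1, p.2) | p <- repr x].
Definition tensor_opp (x : tensor) : tensor := tensor_scale (- 1) x.

Section Lift.
Variables (W : lmodType k) (b : U -> V -> W) (bb : is_bilinear b).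

Lemma tlift0 : tlift b tensor_zero = 0.
Proof. by rewrite tliftE // big_nil. Qed.

Lemma tliftD x y : tlift b (tensor_add x y) = tlift b x + tlift b y.
Proof. by rewrite tliftE // big_cat. Qed.

Lemma tliftZ c x : tlift b (tensor_scale c x) = c *: tlift b x.
Proof.
rewrite tliftE // big_map scaler_sumr; apply: eq_bigr => p _ /=.
exact: (scalable_linear (bb.1 p.2)).
Qed.

Lemma tlift_tens u v : tlift b (tens u v) = b u v.
Proof. by rewrite tliftE // big_seq1. Qed.
End Lift.

Lemma tensor_addA : associative tensor_add.
Proof.
by move=> x y z; apply: tensorP => W b bb; rewrite !tliftD // addrA.
Qed.

Lemma tensor_addC : commutative tensor_add.
Proof.
by move=> x y; apply: tensorP => W b bb; rewrite !tliftD // addrC.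
Qed.

Lemma tensor_add0 : left_id tensor_zero tensor_add.
Proof.
by move=> x; apply: tensorP => W b bb; rewrite tliftD // tlift0 // add0r.
Qed.

Lemma tensor_addN : left_inverse tensor_zero tensor_opp tensor_add.
Proof.
move=> x; apply: tensorP => W b bb.
by rewrite tliftD // tliftZ // tlift0 // scaleN1r addNr.
Qed.

HB.instance Definition _ := GRing.isZmodule.Build tensor
  tensor_addA tensor_addC tensor_add0 tensor_addN.

Lemma tensor_scaleA c d x :
  tensor_scale c (tensor_scale d x) = tensor_scale (c * d) x.
Proof. by apply: tensorP => W b bb; rewrite !tliftZ // scalerA. Qed.

Lemma tensor_scale1 : left_id 1 tensor_scale.
Proof. by move=> x; apply: tensorP => W b bb; rewrite tliftZ // scale1r. Qed.

Lemma tensor_scaleDr : right_distributive tensor_scale +%R.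
Proof.
move=> c x y; apply: tensorP => W b bb.
by rewrite !(tliftZ, tliftD) // scalerDr.
Qed.

Lemma tensor_scaleDl x :
  {morph tensor_scale^~ x : c d / c + d}.
Proof.
move=> c d; apply: tensorP => W b bb.
by rewrite !(tliftZ, tliftD) // scalerDl.
Qed.

HB.instance Definition _ := GRing.Zmodule_isLmodule.Build k tensor
  tensor_scaleA tensor_scale1 tensor_scaleDr tensor_scaleDl.

Lemma tens_bilinear : is_bilinear tens.
Proof.
split=> [v c u u'|u c v v']; apply: tensorP => W b bb;
  rewrite tliftD // tliftZ // !tlift_tens //.
- exact: bb.1.
- exact: bb.2.
Qed.

Lemma tlift_linear (W : lmodType k) (b : U -> V -> W) :
  is_bilinear b -> linear (tlift b).
Proof. by move=> bb c x y; rewrite tliftD // tliftZ. Qed.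

End TensorProduct.
Arguments tens {k U V} u v.

Section TensorMaps.
Variable k : fieldType.
Implicit Types U V W X : lmodType k.

Lemma tlift_id U V (t : tensor U V) : tlift tens t = t.
Proof.
apply: tensorP => W b bb.
pose f := HB.pack_for {linear tensor U V -> W} (tlift b)
  (GRing.isLinear.Build _ _ _ _ _ (tlift_linear bb)).
rewrite -[LHS]/(f _) raddf_sum /=.
by apply: eq_bigr => p _; rewrite tlift_tens.
Qed.

Lemma eq_tlift U V W (b c : U -> V -> W) t :
  (forall u v, b u v = c u v) -> tlift b t = tlift c t.
Proof. by move=> bc; apply: eq_bigr. Qed.

Lemma lin_sum U V (f : U -> V) I (r : seq I) (P : pred I) (F : I -> U) :
  linear f -> f (\sum_(i <- r | P i) F i) = \sum_(i <- r | P i) f (F i).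
Proof.
move=> lf; pose g := HB.pack_for {linear U -> V} f
  (GRing.isLinear.Build _ _ _ _ _ lf).
by rewrite -[LHS]/(g _) raddf_sum.
Qed.

Lemma lin_tlift U V W W' (f : W -> W') (b : U -> V -> W) t :
  linear f -> f (tlift b t) = tlift (fun u v => f (b u v)) t.
Proof. by move=> lf; exact: lin_sum. Qed.

Lemma lin_tensor U V W (f : tensor U V -> W) t :
  linear f -> f t = tlift (fun u v => f (tens u v)) t.
Proof. by move=> lf; rewrite -{1}[t]tlift_id lin_tlift. Qed.

Lemma tlift_swap U V U' V' W (F : U -> V -> U' -> V' -> W) s t :
  tlift (fun u v => tlift (F u v) s) t =
  tlift (fun u' v' => tlift (fun u v => F u v u' v') t) s.
Proof. exact: exchange_big. Qed.

Lemma linZ U V (f : U -> V) : linear f -> forall c x, f (c *: x) = c *: f x.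
Proof. exact: scalable_linear. Qed.

Lemma tensZl U V c (u : U) (v : V) : tens (c *: u) v = c *: tens u v.
Proof. exact: (linZ ((tens_bilinear U V).1 v)). Qed.

Lemma tensZr U V c (u : U) (v : V) : tens u (c *: v) = c *: tens u v.
Proof. exact: (linZ ((tens_bilinear U V).2 u)). Qed.

Lemma lin_id U : linear (fun x : U => x). Proof. by []. Qed.

Lemma lin_app U V W (f : {linear V -> W}) (g : U -> V) :
  linear g -> linear (fun x => f (g x)).
Proof. by move=> lg c x y; rewrite lg linearP. Qed.

Lemma lin_comp U V W (f : V -> W) (g : U -> V) :
  linear f -> linear g -> linear (fun x => f (g x)).
Proof. by move=> lf lg c x y; rewrite lg lf. Qed.

Lemma lin_mull U (A : algType k) (g : U -> A) a :
  linear g -> linear (fun x => a * g x).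
Proof. by move=> lg c x y; rewrite lg mulrDr scalerAr. Qed.

Lemma lin_mulr U (A : algType k) (g : U -> A) a :
  linear g -> linear (fun x => g x * a).
Proof. by move=> lg c x y; rewrite lg mulrDl scalerAl. Qed.

Lemma lin_scalel U W (g : U -> k) (w : W) :
  linear (g : U -> k^o) -> linear (fun x => g x *: w).
Proof. by move=> lg c x y; rewrite lg scalerDl scalerA. Qed.

Lemma lin_scaler U W (g : U -> W) (a : k) :
  linear g -> linear (fun x => a *: g x).
Proof. by move=> lg c x y; rewrite lg scalerDr !scalerA mulrC. Qed.

Lemma lin_tensl U V W (g : U -> V) (w : W) :
  linear g -> linear (fun x => tens (g x) w).
Proof. by move=> lg c x y; rewrite lg (tens_bilinear V W).1. Qed.

Lemma lin_tensr U V W (g : U -> V) (w : W) :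
  linear g -> linear (fun x => tens w (g x)).
Proof. by move=> lg c x y; rewrite lg (tens_bilinear W V).2. Qed.

Lemma lin_tlift_fun U V W X (F : X -> U -> V -> W) t :
  (forall u v, linear (fun x => F x u v)) -> linear (fun x => tlift (F x) t).
Proof.
move=> lF c x y; rewrite /tlift scaler_sumr -big_split /=.
by apply: eq_bigr => p _; rewrite lF.
Qed.

Lemma lin_tlift_arg U V W X (b : U -> V -> W) (g : X -> tensor U V) :
  is_bilinear b -> linear g -> linear (fun x => tlift b (g x)).
Proof. by move=> bb lg c x y; rewrite lg tlift_linear. Qed.

End TensorMaps.

(* [lin] proves linearity and bilinearity goals; the two hooks below are
   redefined as more operations become available. *)
Ltac lin_tensor_mul g h := fail.
Ltac lin_hook f := fail.

Ltac lin :=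
  lazymatch goal with
  | |- is_bilinear _ => split; cbv beta; lin
  | |- GRing.linear_for _ ?f =>
    lazymatch f with
    | (fun x => x) => exact: lin_id
    | (fun x => tlift (@?F x) (@?g x)) =>
        first [refine (@lin_tlift_fun _ _ _ _ _ F _ _)
              | refine (@lin_tlift_arg _ _ _ _ _ _ g _ _)]; lin
    | (fun x => tens (@?g x) (@?h x)) =>
        first [refine (@lin_tensl _ _ _ _ g _ _)
              | refine (@lin_tensr _ _ _ _ h _ _)]; lin
    | (fun x => GRing.scale (@?g x) (@?h x)) =>
        first [refine (@lin_scalel _ _ _ g _ _)
              | refine (@lin_scaler _ _ _ h _ _)]; lin
    | (fun x => GRing.mul (@?g x) (@?h x)) =>
        first [refine (@lin_mull _ _ _ h _ _)
              | refine (@lin_mulr _ _ _ g _ _)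
              | lin_tensor_mul g h]; lin
    | (fun x => GRing.Linear.sort ?h (@?g x)) =>
        refine (@lin_app _ _ _ _ h g _); lin
    | (fun x => _) => first [lin_hook f | solve [auto | eauto] | idtac]
    | _ => change (GRing.linear_for *:%R (fun x => f x)); cbv beta; lin
    end
  | |- forall _, _ => intro; cbv beta; lin
  | |- _ => idtac
  end.

Section TensorMaps2.
Variable k : fieldType.
Implicit Types U V W : lmodType k.

Definition tmap U V U' V' (f : U -> U') (g : V -> V') :
    tensor U V -> tensor U' V' :=
  tlift (fun u v => tens (f u) (g v)).

Lemma tmap_linear U V U' V' (f : {linear U -> U'}) (g : {linear V -> V'}) :
  linear (tmap f g).
Proof. by apply: tlift_linear; lin. Qed.

HB.instance Definition _ U V U' V'
    (f : {linear U -> U'}) (g : {linear V -> V'}) :=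
  GRing.isLinear.Build k (tensor U V) (tensor U' V') _ (tmap f g)
    (tmap_linear f g).

Definition tassoc U V W : tensor (tensor U V) W -> tensor U (tensor V W) :=
  tlift (fun t w => tlift (fun u v => tens u (tens v w)) t).

Lemma tassoc_linear U V W : linear (@tassoc U V W).
Proof. by apply: tlift_linear; lin. Qed.

HB.instance Definition _ U V W :=
  GRing.isLinear.Build k (tensor (tensor U V) W) (tensor U (tensor V W)) _
    (@tassoc U V W) (@tassoc_linear U V W).

Lemma tmap_tens U V U' V' (f : {linear U -> U'}) (g : {linear V -> V'}) u v :
  tmap f g (tens u v) = tens (f u) (g v).
Proof. by rewrite [LHS]tlift_tens //; lin. Qed.
Lemma tensor_ext U V W (f g : tensor U V -> W) :
  linear f -> linear g -> (forall a b, f (tens a b) = g (tens a b)) -> f =1 g.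
Proof.
move=> lf lg fg t; rewrite lin_tensor // [RHS]lin_tensor //.
exact: eq_tlift.
Qed.
End TensorMaps2.

Ltac lin_hook f ::=
  lazymatch f with
  | (fun x => tassoc (@?g x)) =>
      refine (@lin_comp _ _ _ _ _ g (@tassoc_linear _ _ _ _) _); lin
  | (fun x => tmap ?a ?b (@?g x)) =>
      refine (@lin_comp _ _ _ _ (tmap a b) g _ _); [exact: linearP | lin]
  end.

Section TensorAlgebra.
Variables (k : fieldType) (A B : algType k).
Implicit Types x y z : tensor A B.

Definition tensor_mul x y : tensor A B :=
  tlift (fun a b => tlift (fun a' b' => tens (a * a') (b * b')) y) x.

Lemma tensor_mull y : linear (tensor_mul^~ y).
Proof. by rewrite /tensor_mul; lin. Qed.

Lemma tensor_mulr x : linear (tensor_mul x).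
Proof. by rewrite /tensor_mul; lin. Qed.

Lemma tensor_mul_tens a b a' b' :
  tensor_mul (tens a b) (tens a' b') = tens (a * a') (b * b').
Proof. by rewrite /tensor_mul !tlift_tens; lin. Qed.

Lemma tensor_mulA : associative tensor_mul.
Proof.
move=> x y z.
apply: (tensor_ext (f := fun x => tensor_mul x (tensor_mul y z))
  (g := fun x => tensor_mul (tensor_mul x y) z)) x => [||a b] /=.
- exact: tensor_mull.
- by move=> c u v; rewrite !tensor_mull.
apply: (tensor_ext (f := fun y => tensor_mul (tens a b) (tensor_mul y z))
  (g := fun y => tensor_mul (tensor_mul (tens a b) y) z)) y => [||a' b'] /=.
- by move=> c u v; rewrite tensor_mull tensor_mulr.
- by move=> c u v; rewrite tensor_mulr tensor_mull.
apply: (tensor_ext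
  (f := fun z => tensor_mul (tens a b) (tensor_mul (tens a' b') z))
  (g := fun z => tensor_mul (tensor_mul (tens a b) (tens a' b')) z))
  z => [||a'' b''] /=.
- by move=> c u v; rewrite !tensor_mulr.
- exact: tensor_mulr.
by rewrite !tensor_mul_tens !mulrA.
Qed.

Lemma tensor_mul1 : left_id (tens 1 1) tensor_mul.
Proof.
apply: tensor_ext => [||a b]; [exact: tensor_mulr|exact: lin_id|].
by rewrite tensor_mul_tens !mul1r.
Qed.

Lemma tensor_mulr1 : right_id (tens 1 1) tensor_mul.
Proof.
apply: tensor_ext => [||a b]; [exact: tensor_mull|exact: lin_id|].
by rewrite tensor_mul_tens !mulr1.
Qed.

Lemma tensor_mulDl : left_distributive tensor_mul +%R.
Proof. by move=> x y z; have := tensor_mull z 1 x y; rewrite !scale1r. Qed.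

Lemma tensor_mulDr : right_distributive tensor_mul +%R.
Proof. by move=> x y z; have := tensor_mulr x 1 y z; rewrite !scale1r. Qed.

HB.instance Definition _ := GRing.Zmodule_isPzRing.Build (tensor A B)
  tensor_mulA tensor_mul1 tensor_mulr1 tensor_mulDl tensor_mulDr.

Lemma tens_mul (a a' : A) (b b' : B) :
  tens a b * tens a' b' = tens (a * a') (b * b').
Proof. exact: tensor_mul_tens. Qed.

Lemma tensor_mulE x y : x * y =
  tlift (fun a b => tlift (fun a' b' => tens (a * a') (b * b')) y) x.
Proof. by []. Qed.

Lemma lin_tmull (X : lmodType k) (g : X -> tensor A B) x :
  linear g -> linear (fun u => x * g u).
Proof. by move=> lg c u v; rewrite lg; exact: tensor_mulr. Qed.

Lemma lin_tmulr (X : lmodType k) (g : X -> tensor A B) x :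
  linear g -> linear (fun u => g u * x).
Proof. by move=> lg c u v; rewrite lg; exact: tensor_mull. Qed.

Lemma tensor_scalerAl (c : k) x y : c *: (x * y) = (c *: x) * y.
Proof.
exact/esym/(linZ (tensor_mull y)).
Qed.

Lemma tensor_scalerAr (c : k) x y : c *: (x * y) = x * (c *: y).
Proof. exact/esym/(linZ (tensor_mulr x)). Qed.
End TensorAlgebra.

Ltac lin_tensor_mul g h ::=
  first [refine (@lin_tmull _ _ _ _ h _ _) | refine (@lin_tmulr _ _ _ _ g _ _)].

HB.mixin Record Algebra_isHopf (k : fieldType) H of GRing.Algebra k H := {
  comul : {linear H -> tensor H H};
  counit : {linear H -> k^o};
  antipode : {linear H -> H};
  comulA : forall h, tassoc (tmap comul idfun (comul h)) =
                     tmap idfun comul (comul h);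
  counitl : forall h, tlift (fun a b => (counit a : k) *: b) (comul h) = h;
  counitr : forall h, tlift (fun a b => (counit b : k) *: a) (comul h) = h;
  comulM : forall a b, comul (a * b) = comul a * comul b;
  comul1 : comul 1 = 1;
  counitM : forall a b, counit (a * b) = counit a * counit b;
  counit1 : counit 1 = 1;
  antipodel : forall h,
    tlift (fun a b => antipode a * b) (comul h) = (counit h : k)%:A;
  antipoder : forall h,
    tlift (fun a b => a * antipode b) (comul h) = (counit h : k)%:A
}.

#[short(type="hopfAlgType")]
HB.structure Definition HopfAlgebra (k : fieldType) :=
  {H of Algebra_isHopf k H & GRing.Algebra k H}.

Record comodule (k : fieldType) (H : hopfAlgType k) (M : lmodType k) :=
  Comodule {
    coact :> {linear M -> tensor M H};
    coactA : forall m, tassoc (tmap coact idfun (coact m)) =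
                       tmap idfun comul (coact m);
    coact_counit : forall m,
      tlift (fun (m0 : M) (h : H) => (counit h : k) *: m0) (coact m) = m
  }.

Record comodule_algebra (k : fieldType) (H : hopfAlgType k) (A : algType k) :=
  ComoduleAlgebra {
    ca_comodule :> comodule H A;
    coactM : forall a b, ca_comodule (a * b) = ca_comodule a * ca_comodule b;
    coact1 : ca_comodule 1 = 1
  }.


Section Sweedler.
Variables (k : fieldType) (H : hopfAlgType k).

Definition trilinear (M W : lmodType k) (F : M -> H -> H -> W) : Prop :=
  [/\ forall h g, linear (fun m => F m h g),
      forall m g, linear (fun h => F m h g) &
      forall m h, linear (F m h)].

Lemma coactA_tlift (M W : lmodType k) (rho : comodule H M)
    (F : M -> H -> H -> W) m : trilinear F ->
  tlift (fun x h => tlift (fun y g => F y g h) (rho x)) (rho m) =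
  tlift (fun x h => tlift (F x) (comul h)) (rho m).
Proof.
move=> [F1 F2 F3].
pose G : tensor M (tensor H H) -> W := tlift (fun x => tlift (F x)).
have bF x : is_bilinear (F x) by lin.
have bG : is_bilinear (fun x : M => tlift (F x)) by lin.
have lG : linear G by rewrite /G; lin.
have := congr1 G (coactA rho m).
rewrite {1}/tmap [tassoc _]lin_tlift; last exact: tassoc_linear.
rewrite [LHS]lin_tlift // [in RHS]/tmap [RHS]lin_tlift // => E.
transitivity (tlift (fun x h => G (tassoc (tens (rho x) h))) (rho m)).
  apply: eq_tlift => x h; rewrite /tassoc tlift_tens; last by lin.
  rewrite [RHS]lin_tlift //.
  by apply: eq_tlift => y g; rewrite /G tlift_tens // tlift_tens.
rewrite E; apply: eq_tlift => x h.
by rewrite /G tlift_tens.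
Qed.

Definition regular_comodule : comodule H H := Comodule (@comulA k H) counitr.

Lemma comulA_tlift (W : lmodType k) (F : H -> H -> H -> W) x : trilinear F ->
  tlift (fun x h => tlift (fun y g => F y g h) (comul x)) (comul x) =
  tlift (fun x h => tlift (F x) (comul h)) (comul x).
Proof. exact: (coactA_tlift regular_comodule). Qed.

Notation S := (@antipode k H).
Notation D := (@comul k H).
Notation eps h := (@counit k H h : k).

Lemma comul_mul_tlift (W : lmodType k) (b : H -> H -> W) x y :
  is_bilinear b ->
  tlift b (D (x * y)) =
  tlift (fun x1 x2 => tlift (fun y1 y2 => b (x1 * y1) (x2 * y2)) (D y)) (D x).
Proof.
move=> bb; have lb := tlift_linear bb.
rewrite comulM tensor_mulE lin_tlift //; apply: eq_tlift => x1 x2.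
by rewrite lin_tlift //; apply: eq_tlift => y1 y2; rewrite tlift_tens.
Qed.

Lemma antipodeZ (c : k) x : S (c *: x) = c *: S x.
Proof. exact: linearZ. Qed.

Lemma antipode1 : S 1 = 1.
Proof.
have := antipodel (1 : H); rewrite comul1 counit1 scale1r tlift_tens ?mulr1 //.
lin.
Qed.

Lemma antipodeM x y : S (x * y) = S y * S x.
Proof.
pose T := tlift (fun x1 x2 => tlift (fun y1 y2 =>
  tlift (fun x3 x4 => tlift (fun y3 y4 =>
    S (x3 * y3) * (x4 * y4) * (S y2 * S x2)) (D y1)) (D x1)) (D y)) (D x).
transitivity T; last first.
  transitivity (tlift (fun x1 x2 => tlift (fun y1 y2 =>
    eps x1 *: (eps y1 *: (S y2 * S x2))) (D y)) (D x)).
    apply: eq_tlift => x1 x2; apply: eq_tlift => y1 y2.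
    have := congr1 (fun z => z * (S y2 * S x2)) (antipodel (x1 * y1)).
    rewrite comul_mul_tlift; last by lin.
    rewrite -scalerAl mul1r counitM -scalerA => <-.
    rewrite [RHS](lin_tlift (f := fun z => z * _)); last by lin.
    apply: eq_tlift => x3 x4; rewrite [RHS](lin_tlift (f := fun z => z * _)) //.
    by lin.
  rewrite -[in RHS](counitl x) [in RHS](lin_tlift (f := fun z => _ * S z));
    last by lin.
  apply: eq_tlift => x1 x2.
  rewrite -[in RHS](counitl y) antipodeZ -scalerAr.
  rewrite (lin_tlift (f := fun z => _ *: (S z * _))); last by lin.
  by apply: eq_tlift => y1 y2; rewrite antipodeZ -scalerAl.
transitivity (tlift (fun x1 x2 => tlift (fun y1 y2 =>
  tlift (fun x3 x4 => tlift (fun y3 y4 =>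
    S (x1 * y1) * (x3 * y3) * (S y4 * S x4)) (D y2)) (D x2)) (D y)) (D x)).
  rewrite -{1}(counitr x) (lin_tlift (f := fun z => S (z * _))); last by lin.
  apply: eq_tlift => x1 x2.
  rewrite -{1}(counitr y) (lin_tlift (f := fun z => S (_ * z))); last by lin.
  apply: eq_tlift => y1 y2.
  rewrite -scalerAl -scalerAr !antipodeZ.
  transitivity (tlift (fun x3 x4 => eps y2 *: (S (x1 * y1) * (x3 * S x4)))
    (D x2)).
    rewrite -(lin_tlift (f := fun z => eps y2 *: (_ * z))); last by lin.
    by rewrite antipoder -scalerAr mulr1 scalerA mulrC -scalerA.
  apply: eq_tlift => x3 x4.
  transitivity (S (x1 * y1) * x3 * ((eps y2)%:A * S x4)).
    by rewrite -!scalerAl mul1r -scalerAr mulrA.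
  rewrite -antipoder (lin_tlift (f := fun z => _ * (z * _))); last by lin.
  by apply: eq_tlift => y3 y4; rewrite !mulrA.
rewrite /T.
transitivity (tlift (fun x1 x2 => tlift (fun x3 x4 => tlift (fun y1 y2 =>
  tlift (fun y3 y4 =>
    S (x3 * y3) * (x4 * y4) * (S y2 * S x2)) (D y1)) (D y)) (D x1)) (D x)).
  rewrite (comulA_tlift (F := fun x3 x4 x2 => tlift (fun y1 y2 =>
  tlift (fun y3 y4 =>
    S (x3 * y3) * (x4 * y4) * (S y2 * S x2)) (D y1)) (D y)));
    last by split; lin.
  apply: eq_tlift => x1 x2; rewrite tlift_swap; apply: eq_tlift => x3 x4.
  rewrite (comulA_tlift (F := fun y3 y4 y2 =>
    S (x1 * y3) * (x3 * y4) * (S y2 * S x4))) //; last by split; lin.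
by apply: eq_tlift => x1 x2; rewrite tlift_swap.
Qed.

Lemma counit_antipode x : counit (S x) = counit x.
Proof.
have := congr1 (@counit k H) (antipodel x).
rewrite linearZ /= counit1 [RHS]mulr1 => <-.
rewrite -{1}(counitr x) (lin_tlift (f := fun z => counit (S z))); last by lin.
rewrite [RHS]lin_tlift; last by lin.
apply: eq_tlift => x1 x2.
by rewrite antipodeZ linearZ /= counitM mulrC.
Qed.

Lemma comul_antipode x :
  D (S x) = tlift (fun x1 x2 => tens (S x2) (S x1)) (D x).
Proof.
pose K y : tensor H H := tlift (fun y1 y2 => tens (S y2) (S y1)) (D y).
have lK : linear K by rewrite /K; lin.
have DK y : tlift (fun a b => D a * K b) (D y) = eps y *: (1 : tensor H H).
  transitivity (tlift (fun a b => tlift (fun a1 a2 => tlift (fun b1 b2 =>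
    tens (a1 * S b2) (a2 * S b1)) (D b)) (D a)) (D y)).
    apply: eq_tlift => a b.
    rewrite (lin_tensor (f := fun t => t * K b) (D a)); last by lin.
    apply: eq_tlift => a1 a2.
    rewrite lin_tlift; last by lin.
    by apply: eq_tlift => b1 b2; rewrite tens_mul.
  rewrite (comulA_tlift (F := fun a1 a2 b => tlift (fun b1 b2 =>
    tens (a1 * S b2) (a2 * S b1)) (D b))); last by split; lin.
  transitivity (tlift (fun a b => tens (a * S b) (1 : H)) (D y)).
    apply: eq_tlift => a b.
    rewrite -(comulA_tlift (F := fun c b1 b2 => tens (a * S b2) (c * S b1)));
      last by split; lin.
    rewrite -{2}(counitl b) (lin_tlift (f := fun z => tens (a * S z) _));
      last by lin.
    apply: eq_tlift => e b2.
    rewrite -(lin_tlift (f := fun z => tens (a * S b2) z)); last by lin.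
    rewrite antipoder antipodeZ -scalerAr.
    by rewrite tensZl tensZr.
  rewrite -(lin_tlift (f := fun z => tens z 1)); last by lin.
  by rewrite antipoder tensZl.
pose T := tlift (fun x1 x2 => tlift (fun x3 x4 => D (S x3) * D x4 * K x2)
  (D x1)) (D x).
transitivity T.
  rewrite /T (comulA_tlift (F := fun x3 x4 x2 => D (S x3) * D x4 * K x2));
    last by split; lin.
  rewrite -{1}(counitr x) (lin_tlift (f := fun z => D (S z))); last by lin.
  apply: eq_tlift => x1 x2.
  transitivity (D (S x1) * (eps x2 *: (1 : tensor H H))).
    by rewrite antipodeZ -tensor_scalerAr mulr1 linearZ.
  rewrite -DK lin_tlift; last by lin.
  by apply: eq_tlift => x3 x4; rewrite mulrA.
rewrite /T -/(K x) -[in RHS](counitl x) [RHS]lin_tlift //.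
apply: eq_tlift => x1 x2.
rewrite -(lin_tlift (f := fun z : tensor H H => z * K x2)); last by lin.
transitivity (D (eps x1 *: 1) * K x2).
  rewrite -antipodel (lin_tlift (f := D)); last by lin.
  by congr (_ * _); apply: eq_tlift => a b; rewrite comulM.
by rewrite linearZ /= comul1 -tensor_scalerAl mul1r (linZ lK).
Qed.
End Sweedler.

(* Sums over Sweedler components are nested [tlift]s; module actions are plain
   functions, since A already carries its own k-linear scaling. *)
Section DoiHopf.
Variables (k : fieldType) (H : hopfAlgType k) (A : algType k).
Variable R : comodule_algebra H A.

Record left_doi_hopf := LeftDoiHopf {
  ldh_sort :> lmodType k;
  lact : A -> ldh_sort -> ldh_sort;
  lact_bilinear : is_bilinear (lact : (A : lmodType k) -> _);
  lact1 : forall m, lact 1 m = m;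
  lactM : forall a b m, lact (a * b) m = lact a (lact b m);
  ldh_coact : comodule H ldh_sort;
  lact_coact : forall a m, ldh_coact (lact a m) =
    tlift (fun (a0 : A) (a1 : H) =>
      tlift (fun (m0 : ldh_sort) (m1 : H) => tens (lact a0 m0) (a1 * m1))
        (ldh_coact m)) (R a)
}.

Record right_doi_hopf := RightDoiHopf {
  rdh_sort :> lmodType k;
  ract : rdh_sort -> A -> rdh_sort;
  ract_bilinear : is_bilinear (ract : _ -> (A : lmodType k) -> _);
  ract1 : forall m, ract m 1 = m;
  ractM : forall m a b, ract m (a * b) = ract (ract m a) b;
  rdh_coact : comodule H rdh_sort;
  ract_coact : forall m a, rdh_coact (ract m a) =
    tlift (fun (m0 : rdh_sort) (m1 : H) =>
      tlift (fun (a0 : A) (a1 : H) => tens (ract m0 a0) (m1 * a1))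
        (R a)) (rdh_coact m)
}.

Definition colinear (M N : lmodType k) (cM : comodule H M) (cN : comodule H N)
    (f : M -> N) : Prop :=
  forall m, cN (f m) = tmap f idfun (cM m).

Definition left_doi_hopf_hom (M N : left_doi_hopf) (f : M -> N) : Prop :=
  [/\ linear f, forall a m, f (lact a m) = lact a (f m) &
      colinear (ldh_coact M) (ldh_coact N) f].

Definition right_doi_hopf_hom (M N : right_doi_hopf) (f : M -> N) : Prop :=
  [/\ linear f, forall m a, f (ract m a) = ract (f m) a &
      colinear (rdh_coact M) (rdh_coact N) f].

Definition left_doi_hopf_iso (M N : left_doi_hopf) : Prop :=
  exists f g, [/\ left_doi_hopf_hom f, left_doi_hopf_hom g,
    @cancel N M f g & @cancel M N g f].

Definition right_doi_hopf_iso (M N : right_doi_hopf) : Prop :=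
  exists f g, [/\ right_doi_hopf_hom f, right_doi_hopf_hom g,
    @cancel N M f g & @cancel M N g f].

Lemma mul_bilinear : is_bilinear (fun a b : A => a * b).
Proof. by lin. Qed.

Definition left_regular : left_doi_hopf :=
  LeftDoiHopf mul_bilinear (@mul1r A)
    (fun a b c => esym (mulrA a b c)) (coactM R).

Definition right_regular : right_doi_hopf :=
  RightDoiHopf mul_bilinear (@mulr1 A) (@mulrA A) (coactM R).
End DoiHopf.


Section Twist.
Variables (k : fieldType) (H : hopfAlgType k).
Notation S := (@antipode k H).
Notation D := (@comul k H).
Notation eps h := (@counit k H h : k).

Lemma comul_antipode2 h : D (S (S h)) = tmap (S \o S) (S \o S) (D h).
Proof.
rewrite comul_antipode comul_antipode lin_tlift; last by lin.
by apply: eq_tlift => a b; rewrite tlift_tens //; lin.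
Qed.

Variables (A : algType k) (R : comodule_algebra H A).

(* The comodule algebra [twist R] is A with its coaction twisted by the square
   of the antipode, often written A^(S^2). *)
Definition twist_coact : {linear A -> tensor A H} := tmap idfun (S \o S) \o R.

Lemma twist_coactE a :
  twist_coact a = tlift (fun a0 a1 => tens a0 (S (S a1))) (R a).
Proof. by []. Qed.

Lemma twist_coactA a : tassoc (tmap twist_coact idfun (twist_coact a)) =
  tmap idfun D (twist_coact a).
Proof.
rewrite twist_coactE [LHS](lin_tlift (f := fun z => tassoc (tmap _ _ z)));
  last by lin.
rewrite [RHS]lin_tlift; last by lin.
transitivity (tlift (fun a0 a1 => tlift (fun a2 a3 =>
    tens a2 (tens (S (S a3)) (S (S a1)))) (R a0)) (R a)).
  apply: eq_tlift => a0 a1; rewrite tmap_tens twist_coactE.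
  rewrite /tassoc tlift_tens; last by lin.
  rewrite lin_tlift; last by lin.
  by apply: eq_tlift => a2 a3; rewrite tlift_tens //; lin.
rewrite (coactA_tlift R (F := fun a2 a3 a1 =>
  tens a2 (tens (S (S a3)) (S (S a1))))); last by split; lin.
apply: eq_tlift => a0 a1; rewrite tmap_tens comul_antipode2.
by rewrite [in RHS]lin_tlift //; lin.
Qed.

Lemma twist_coact_counit a :
  tlift (fun (a0 : A) (a1 : H) => eps a1 *: a0) (twist_coact a) = a.
Proof.
rewrite twist_coactE lin_tlift; last by lin.
rewrite -[RHS](coact_counit R); apply: eq_tlift => a0 a1.
by rewrite tlift_tens ?counit_antipode ?counit_antipode //; lin.
Qed.

Definition twist_comodule := Comodule twist_coactA twist_coact_counit.

Lemma twist_coactM a b :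
  twist_comodule (a * b) = twist_comodule a * twist_comodule b.
Proof.
rewrite [LHS]/= coactM tensor_mulE [LHS]lin_tlift; last by lin.
rewrite [twist_comodule a]twist_coactE.
rewrite [RHS](lin_tlift (f := fun z : tensor A H => z * twist_comodule b));
  last by lin.
apply: eq_tlift => a0 a1; rewrite lin_tlift; last by lin.
rewrite [twist_comodule b]twist_coactE.
rewrite [RHS](lin_tlift (f := fun z : tensor A H => tens _ _ * z));
  last by lin.
by apply: eq_tlift => b0 b1; rewrite tmap_tens tens_mul /= !antipodeM.
Qed.

Lemma twist_coact1 : twist_comodule 1 = 1.
Proof. by rewrite /= coact1 [LHS]tmap_tens /= !antipode1. Qed.

Definition twist : comodule_algebra H A :=
  ComoduleAlgebra twist_coactM twist_coact1.
End Twist.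

Section Dual.
Variables (k : fieldType) (A : falgType k).

Definition dual : vectType k := 'Hom(A, k^o).

(* Contraction of the dual factor of a tensor at x. *)
Definition dual_eval (W : lmodType k) (x : A) (t : tensor dual W) : W :=
  tlift (fun (f : dual) w => (f x : k) *: w) t.

Definition dual_basis (i : 'I_(\dim {:A})) : dual :=
  linfun (coord (vbasis {:A}) i : A -> k^o).

Lemma lin_lfunl (X : lmodType k) (g : X -> dual) a :
  linear g -> linear (fun x => g x a).
Proof. by move=> lg c x y; rewrite lg add_lfunE scale_lfunE. Qed.

Lemma lin_lfunr (X : lmodType k) (g : X -> A) (f : dual) :
  linear g -> linear (fun x => f (g x)).
Proof. by move=> lg c x y; rewrite lg linearP. Qed.
End Dual.

Ltac lin_hook f ::=
  lazymatch f with
  | (fun x => tassoc (@?g x)) =>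
      refine (@lin_comp _ _ _ _ _ g (@tassoc_linear _ _ _ _) _); lin
  | (fun x => tmap ?a ?b (@?g x)) =>
      refine (@lin_comp _ _ _ _ (tmap a b) g _ _); [exact: linearP | lin]
  | (fun x => fun_of_lfun (@?g x) (@?h x)) =>
      first [refine (@lin_lfunl _ _ _ g _ _)
            | refine (@lin_lfunr _ _ _ h _ _)]; lin
  end.

Section DualTheory.
Variables (k : fieldType) (A : falgType k).
Notation dual := (dual A).

Lemma dual_eval_linear (W : lmodType k) x : linear (@dual_eval k A W x).
Proof. by rewrite /dual_eval; lin. Qed.

Lemma dual_eval_tens (W : lmodType k) x (f : dual) (w : W) :
  dual_eval x (tens f w) = (f x : k) *: w.
Proof. by rewrite /dual_eval tlift_tens //; lin. Qed.

Lemma dual_sum (f : dual) :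
  f = \sum_(i < \dim {:A}) (f (vbasis {:A})`_i : k) *: dual_basis i.
Proof.
apply/lfunP => x; rewrite {1}(coord_vbasis (memvf x)) linear_sum sum_lfunE.
apply: eq_bigr => i _.
by rewrite scale_lfunE linearZ /= [RHS]mulrC /dual_basis lfunE.
Qed.

Lemma dual_tensor_sum (W : lmodType k) (t : tensor dual W) :
  t = \sum_(i < \dim {:A}) tens (dual_basis i) (dual_eval (vbasis {:A})`_i t).
Proof.
apply: (tensor_ext (f := fun t => t) (g := fun t : tensor dual W =>
  \sum_(i < \dim {:A}) tens (dual_basis i) (dual_eval (vbasis {:A})`_i t))) t
  => [|c x y|f w].
- by [].
- rewrite scaler_sumr -big_split; apply: eq_bigr => i _.
  by rewrite dual_eval_linear (tens_bilinear _ _).2.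
rewrite {1}(dual_sum f).
rewrite (lin_sum _ _ _ ((tens_bilinear dual W).1 w)).
by apply: eq_bigr => i _; rewrite dual_eval_tens tensZl tensZr.
Qed.

Lemma dual_eval_inj (W : lmodType k) (s t : tensor dual W) :
  (forall x, dual_eval x s = dual_eval x t) -> s = t.
Proof.
move=> st; rewrite [s]dual_tensor_sum [t]dual_tensor_sum.
by apply: eq_bigr => i _; rewrite st.
Qed.
End DualTheory.

Section DualModules.
Variables (k : fieldType) (H : hopfAlgType k) (A : falgType k).
Variable R : comodule_algebra H A.
Notation dual := (dual A).
Notation S := (@antipode k H).
Notation D := (@comul k H).
Notation eps h := (@counit k H h : k).

Lemma coact_mul_tlift (W : lmodType k) (b : A -> H -> W) x y :
  is_bilinear b ->
  tlift b (R (x * y)) =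
  tlift (fun x1 x2 => tlift (fun y1 y2 => b (x1 * y1) (x2 * y2)) (R y)) (R x).
Proof.
move=> bb; have lb := tlift_linear bb.
rewrite coactM tensor_mulE lin_tlift //; apply: eq_tlift => x1 x2.
by rewrite lin_tlift //; apply: eq_tlift => y1 y2; rewrite tlift_tens.
Qed.

(* In Sweedler notation, the sum of the f(x_0) S(x_1). *)
Definition dual_antipode (f : dual) (x : A) : H :=
  tlift (fun (x0 : A) (x1 : H) => (f x0 : k) *: S x1) (R x).

(* The choice of basis is immaterial, see [dual_coactE]. *)
Definition dual_coact (f : dual) : tensor dual H :=
  \sum_(i < \dim {:A}) tens (dual_basis i) (dual_antipode f (vbasis {:A})`_i).

Lemma dual_antipode_linearl x : linear (dual_antipode^~ x).
Proof. by rewrite /dual_antipode; lin. Qed.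

Lemma dual_antipode_linearr f : linear (dual_antipode f).
Proof. by rewrite /dual_antipode; lin. Qed.

Lemma dual_coact_linear : linear dual_coact.
Proof.
move=> c f g; rewrite /dual_coact scaler_sumr -big_split.
by apply: eq_bigr => i _; rewrite dual_antipode_linearl (tens_bilinear _ _).2.
Qed.

HB.instance Definition _ :=
  GRing.isLinear.Build k dual (tensor dual H) _ dual_coact dual_coact_linear.

(* By [dual_eval_inj], this property determines [dual_coact f]. *)
Lemma dual_coactE f x : dual_eval x (dual_coact f) = dual_antipode f x.
Proof.
rewrite (lin_sum _ _ _ (@dual_eval_linear _ _ _ x)).
rewrite [in RHS](coord_vbasis (memvf x)).
rewrite (lin_sum _ _ _ (dual_antipode_linearr f)).
apply: eq_bigr => i _; rewrite dual_eval_tens (linZ (dual_antipode_linearr f)).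
by rewrite /dual_basis lfunE.
Qed.

Lemma dual_eval_map (W W' : lmodType k) (g : {linear W -> W'}) x
    (t : tensor dual W) :
  dual_eval x (tmap idfun g t) = g (dual_eval x t).
Proof.
rewrite /tmap [LHS]lin_tlift; last by exact: dual_eval_linear.
rewrite [in RHS]/dual_eval [RHS]lin_tlift; last by lin.
by apply: eq_tlift => f w; rewrite dual_eval_tens linearZ.
Qed.

Lemma dual_eval_assoc (W W' : lmodType k) x (s : tensor dual W) (w : W') :
  dual_eval x (tassoc (tens s w)) = tens (dual_eval x s) w.
Proof.
rewrite /tassoc tlift_tens; last by lin.
rewrite [LHS]lin_tlift; last by exact: dual_eval_linear.
rewrite [in RHS]/dual_eval [RHS](lin_tlift (f := fun z => tens z w));
  last by lin.
by apply: eq_tlift => f u; rewrite dual_eval_tens tensZl.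
Qed.

Lemma dual_coactA f : tassoc (tmap dual_coact idfun (dual_coact f)) =
  tmap idfun D (dual_coact f).
Proof.
apply: dual_eval_inj => x; rewrite dual_eval_map dual_coactE.
transitivity (tlift (fun (x0 : A) (x1 : H) =>
    tens (S x1) (dual_antipode f x0)) (R x)).
  rewrite [X in tassoc X]/tmap.
  rewrite (lin_tlift (f := fun z => dual_eval x (tassoc z))); last first.
    refine (@lin_comp _ _ _ _ (@dual_eval _ _ _ x) _ _ _); last by lin.
    exact: dual_eval_linear.
  transitivity (tlift (fun (g : dual) (h : H) => tlift (fun (x0 : A) (x1 : H) =>
      (g x0 : k) *: tens (S x1) h) (R x)) (dual_coact f)).
    apply: eq_tlift => g h; rewrite dual_eval_assoc dual_coactE.
    rewrite /dual_antipode (lin_tlift (f := fun z => tens z h)); last by lin.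
    by apply: eq_tlift => x0 x1; rewrite tensZl.
  rewrite tlift_swap; apply: eq_tlift => x0 x1.
  rewrite -dual_coactE [RHS](lin_tlift (f := fun z => tens _ z));
    last by lin.
  by apply: eq_tlift => g h; rewrite tensZr.
rewrite /dual_antipode [RHS]lin_tlift; last by lin.
transitivity (tlift (fun x0 x1 => tlift (fun x2 x3 =>
    (f x2 : k) *: tens (S x1) (S x3)) (R x0)) (R x)).
  apply: eq_tlift => x0 x1; rewrite (lin_tlift (f := fun z => tens _ z));
    last by lin.
  by apply: eq_tlift => x2 x3; rewrite tensZr.
rewrite (coactA_tlift R (F := fun x2 x3 x1 =>
  (f x2 : k) *: tens (S x1) (S x3))); last by split; lin.
apply: eq_tlift => x0 x1; rewrite linearZ /= comul_antipode.
by rewrite -(lin_tlift (f := fun z => (f x0 : k) *: z)) //; lin.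
Qed.

Lemma dual_coact_counit f :
  tlift (fun (f0 : dual) (h : H) => eps h *: f0) (dual_coact f) = f.
Proof.
apply/lfunP => x.
rewrite (lin_tlift (f := fun g : dual => g x : k^o)); last by lin.
transitivity (counit (dual_eval x (dual_coact f))).
  rewrite [RHS]lin_tlift; last by lin.
  by apply: eq_tlift => g h; rewrite scale_lfunE linearZ /= [RHS]mulrC.
rewrite dual_coactE lin_tlift; last by lin.
rewrite -{2}(coact_counit R x) [RHS]lin_tlift; last by lin.
apply: eq_tlift => x0 x1.
by rewrite !linearZ /= counit_antipode [RHS]mulrC.
Qed.

Definition dual_comodule : comodule H dual :=
  Comodule dual_coactA dual_coact_counit.

Definition dual_ract (f : dual) (a : A) : dual := (f \o amull a)%VF.
Definition dual_lact (a : A) (f : dual) : dual := (f \o amulr a)%VF.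

Lemma dual_ractE f a x : dual_ract f a x = f (a * x).
Proof. by rewrite comp_lfunE lfunE. Qed.

Lemma dual_lactE a f x : dual_lact a f x = f (x * a).
Proof. by rewrite comp_lfunE lfunE. Qed.

Lemma dual_ract_bilinear : is_bilinear (dual_ract : dual -> A -> dual).
Proof.
split=> [a c f g|f c a b]; apply/lfunP => x; rewrite add_lfunE scale_lfunE.
  by rewrite !dual_ractE add_lfunE scale_lfunE.
by rewrite !dual_ractE mulrDl -scalerAl linearP.
Qed.

Lemma dual_lact_bilinear : is_bilinear (dual_lact : A -> dual -> dual).
Proof.
split=> [f c a b|a c f g]; apply/lfunP => x; rewrite add_lfunE scale_lfunE.
  by rewrite !dual_lactE mulrDr -scalerAr linearP.
by rewrite !dual_lactE add_lfunE scale_lfunE.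
Qed.

Lemma dual_ract1 f : dual_ract f 1 = f.
Proof. by apply/lfunP => x; rewrite dual_ractE mul1r. Qed.

Lemma dual_lact1 f : dual_lact 1 f = f.
Proof. by apply/lfunP => x; rewrite dual_lactE mulr1. Qed.

Lemma dual_ractM f a b : dual_ract f (a * b) = dual_ract (dual_ract f a) b.
Proof. by apply/lfunP => x; rewrite !dual_ractE mulrA. Qed.

Lemma dual_lactM a b f : dual_lact (a * b) f = dual_lact a (dual_lact b f).
Proof. by apply/lfunP => x; rewrite !dual_lactE mulrA. Qed.

Lemma dual_ract_coact f a : dual_comodule (dual_ract f a) =
  tlift (fun (f0 : dual) (f1 : H) =>
    tlift (fun (a0 : A) (a1 : H) => tens (dual_ract f0 a0) (f1 * a1)) (R a))
    (dual_comodule f).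
Proof.
apply: dual_eval_inj => x; rewrite [dual_comodule _]/= dual_coactE.
rewrite [RHS]lin_tlift; last by exact: dual_eval_linear.
transitivity (tlift (fun (a0 : A) (a1 : H) =>
    dual_antipode f (a0 * x) * a1) (R a)); last first.
  transitivity (tlift (fun (f0 : dual) (f1 : H) => tlift
      (fun (a0 : A) (a1 : H) => (f0 (a0 * x) : k) *: (f1 * a1)) (R a))
      (dual_coact f)); last first.
    apply: eq_tlift => f0 f1.
    rewrite [RHS]lin_tlift; last by exact: dual_eval_linear.
    by apply: eq_tlift => a0 a1; rewrite dual_eval_tens dual_ractE.
  rewrite [RHS]tlift_swap; apply: eq_tlift => a0 a1.
  rewrite -dual_coactE (lin_tlift (f := fun z => z * a1)); last by lin.
  by apply: eq_tlift => f0 f1; rewrite scalerAl.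
transitivity (tlift (fun (a0 : A) (a1 : H) => tlift (fun (b0 : A) (b1 : H) =>
    tlift (fun (x0 : A) (x1 : H) =>
      (f (b0 * x0) : k) *: (S (b1 * x1) * a1)) (R x)) (R a0)) (R a));
  last first.
  apply: eq_tlift => a0 a1; rewrite /dual_antipode coact_mul_tlift; last by lin.
  rewrite [RHS](lin_tlift (f := fun z => z * a1)); last by lin.
  apply: eq_tlift => b0 b1.
  rewrite [RHS](lin_tlift (f := fun z => z * a1)); last by lin.
  by apply: eq_tlift => x0 x1; rewrite scalerAl.
rewrite (coactA_tlift R (F := fun b0 b1 a1 => tlift (fun (x0 : A) (x1 : H) =>
      (f (b0 * x0) : k) *: (S (b1 * x1) * a1)) (R x))); last by split; lin.
transitivity (tlift (fun (a0 : A) (h : H) => tlift (fun (x0 : A) (x1 : H) =>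
    (f ((eps h *: a0) * x0) : k) *: S x1) (R x)) (R a)).
  rewrite tlift_swap /dual_antipode; apply: eq_tlift => x0 x1.
  rewrite dual_ractE -{1}(coact_counit R a).
  by rewrite (lin_tlift (f := fun z => (f (z * x0) : k) *: S x1)) //; lin.
apply: eq_tlift => a0 h; rewrite tlift_swap; apply: eq_tlift => x0 x1.
transitivity ((f (a0 * x0) : k) *: (S x1 * (eps h)%:A)).
  by rewrite -scalerAl linearZ /= -scalerAr mulr1 scalerA mulrC.
rewrite -antipodel (lin_tlift (f := fun z => (f (a0 * x0) : k) *: (S x1 * z)));
  last by lin.
by apply: eq_tlift => b1 a1; rewrite antipodeM mulrA.
Qed.

Lemma dual_lact_coact a f : dual_comodule (dual_lact a f) =
  tlift (fun (a0 : A) (a1 : H) =>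
    tlift (fun (f0 : dual) (f1 : H) => tens (dual_lact a0 f0) (a1 * f1))
      (dual_comodule f)) (twist R a).
Proof.
apply: dual_eval_inj => x; rewrite [dual_comodule _]/= dual_coactE.
rewrite [RHS]lin_tlift; last by exact: dual_eval_linear.
transitivity (tlift (fun (a0 : A) (a1 : H) =>
    S (S a1) * dual_antipode f (x * a0)) (R a)); last first.
  transitivity (tlift (fun (a0 : A) (a1 : H) =>
    a1 * dual_antipode f (x * a0)) (twist R a)).
    rewrite [in RHS]twist_coactE [RHS](lin_tlift (f := tlift _)).
      by apply: eq_tlift => a0 a1; rewrite tlift_tens //;
        rewrite /dual_antipode; lin.
    by rewrite /dual_antipode; lin.
  apply: eq_tlift => a0 a1.
  rewrite [RHS]lin_tlift; last by exact: dual_eval_linear.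
  rewrite -dual_coactE (lin_tlift (f := fun z => a1 * z)); last by lin.
  apply: eq_tlift => f0 f1.
  by rewrite dual_eval_tens dual_lactE scalerAr.
transitivity (tlift (fun (a0 : A) (a1 : H) => tlift (fun (b0 : A) (b1 : H) =>
    tlift (fun (x0 : A) (x1 : H) =>
      (f (x0 * b0) : k) *: (S (S a1) * S (x1 * b1))) (R x)) (R a0)) (R a));
  last first.
  apply: eq_tlift => a0 a1; rewrite /dual_antipode coact_mul_tlift; last by lin.
  rewrite tlift_swap [RHS](lin_tlift (f := fun z => _ * z)); last by lin.
  apply: eq_tlift => b0 b1.
  rewrite [RHS](lin_tlift (f := fun z => _ * z)); last by lin.
  by apply: eq_tlift => x0 x1; rewrite scalerAr.
rewrite (coactA_tlift R (F := fun b0 b1 a1 => tlift (fun (x0 : A) (x1 : H) =>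
      (f (x0 * b0) : k) *: (S (S a1) * S (x1 * b1))) (R x)));
  last by split; lin.
transitivity (tlift (fun (a0 : A) (h : H) => tlift (fun (x0 : A) (x1 : H) =>
    (f (x0 * (eps h *: a0)) : k) *: S x1) (R x)) (R a)).
  rewrite tlift_swap /dual_antipode; apply: eq_tlift => x0 x1.
  rewrite dual_lactE -{1}(coact_counit R a).
  by rewrite (lin_tlift (f := fun z => (f (x0 * z) : k) *: S x1)) //; lin.
apply: eq_tlift => a0 h; rewrite tlift_swap; apply: eq_tlift => x0 x1.
transitivity ((f (x0 * a0) : k) *: S (x1 * (eps h)%:A)).
  by rewrite -scalerAr linearZ /= -scalerAr mulr1 antipodeZ scalerA mulrC.
rewrite -antipoder (lin_tlift (f := fun z => (f (x0 * a0) : k) *: S (x1 * z)));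
  last by lin.
by apply: eq_tlift => b1 a1; rewrite -antipodeM mulrA.
Qed.

Definition dual_right : right_doi_hopf R :=
  RightDoiHopf dual_ract_bilinear dual_ract1 dual_ractM dual_ract_coact.

Definition dual_left : left_doi_hopf (twist R) :=
  LeftDoiHopf dual_lact_bilinear dual_lact1 dual_lactM dual_lact_coact.

Definition right_Frobenius : Prop :=
  right_doi_hopf_iso (right_regular R) dual_right.

Definition left_Frobenius : Prop :=
  left_doi_hopf_iso (left_regular (twist R)) dual_left.
End DualModules.

(* Main.v *)
From HB Require Import structures.
Require Import Defs.
From mathcomp Require Import all_boot all_order all_algebra all_field.

(** A morphism from the regular Doi-Hopf module of [R] to a Doi-Hopf module [M]
    is determined by the image [m] of 1, and [m] has to be coinvariant, since 1
    is: the coaction sends [m] to the pure tensor of [m] and 1. Conversely,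
    acting on any coinvariant [m] is a morphism, because the coaction of [M] is
    compatible with the action. So the regular module is isomorphic to [M]
    exactly when some coinvariant [m] freely generates [M]
    ([right_regular_isoP], [left_regular_isoP]).

    The two duals of A, over R on the right and over [twist R] on the left, are
    the same comodule, so they have the same coinvariants. Hence A is right
    (resp. left) Frobenius if and only if there is a coinvariant form l on A
    such that a |-> l (a * -) (resp. a |-> l (- * a)) is a bijection from A to
    its dual. These two maps are the transposes of each other, and A is finite
    dimensional, so each is bijective when the other one is
    ([dual_ract_lact_bij], [dual_lact_ract_bij]): the same form witnesses both
    properties. *)

Set Implicit Arguments.
Unset Strict Implicit.
Unset Printing Implicit Defensive.

Import GRing.Theory.
Local Open Scope ring_scope.

Section Coinvariants.
Variables (k : fieldType) (H : hopfAlgType k).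

Definition coinvariant (M : lmodType k) (rho : comodule H M) (m : M) : Prop :=
  rho m = tens m 1.

Lemma tmapl_tens (M N : lmodType k) (f : M -> N) m (h : H) :
  linear f -> tmap f idfun (tens m h) = tens (f m) h.
Proof. by move=> lf; rewrite /tmap tlift_tens //; lin. Qed.

Lemma tmapl_linear (M N : lmodType k) (f : M -> N) :
  linear f -> linear (tmap f (idfun : H -> H)).
Proof. by move=> lf; apply: tlift_linear; lin. Qed.

Lemma colinear_coinvariant (M N : lmodType k) (cM : comodule H M)
    (cN : comodule H N) (f : M -> N) m :
  linear f -> colinear cM cN f -> coinvariant cM m -> coinvariant cN (f m).
Proof. by move=> lf cf cm; rewrite /coinvariant cf cm tmapl_tens. Qed.

Lemma inv_linear (M N : lmodType k) (f : M -> N) (g : N -> M) :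
  linear f -> cancel f g -> cancel g f -> linear g.
Proof. by move=> lf fK gK c x y; rewrite -[RHS]fK lf !gK. Qed.

Lemma inv_colinear (M N : lmodType k) (cM : comodule H M) (cN : comodule H N)
    (f : M -> N) (g : N -> M) :
  linear f -> cancel f g -> cancel g f ->
  colinear cM cN f -> colinear cN cM g.
Proof.
move=> lf fK gK cf n; have lg := inv_linear lf fK gK.
rewrite -{2}[n]gK cf.
apply: (tensor_ext (f := id)
  (g := fun t => tmap g idfun (tmap f idfun t)) _ _ _ (cM (g n))) => // [|m h].
- by apply: lin_comp; exact: tmapl_linear.
- by rewrite !tmapl_tens // fK.
Qed.
End Coinvariants.

Section RegularModules.
Variables (k : fieldType) (H : hopfAlgType k) (A : algType k).
Variable R : comodule_algebra H A.

Lemma regular_coinvariant1 : coinvariant R 1.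
Proof. exact: coact1. Qed.

Lemma inv_right_doi_hopf_hom (M N : right_doi_hopf R) (f : M -> N)
    (g : N -> M) :
  cancel f g -> cancel g f -> right_doi_hopf_hom f -> right_doi_hopf_hom g.
Proof.
move=> fK gK [lf af cf]; split; first exact: inv_linear lf fK gK.
- by move=> n a; rewrite -[RHS]fK af gK.
- exact: inv_colinear cf.
Qed.

Lemma inv_left_doi_hopf_hom (M N : left_doi_hopf R) (f : M -> N)
    (g : N -> M) :
  cancel f g -> cancel g f -> left_doi_hopf_hom f -> left_doi_hopf_hom g.
Proof.
move=> fK gK [lf af cf]; split; first exact: inv_linear lf fK gK.
- by move=> a n; rewrite -[RHS]fK af gK.
- exact: inv_colinear cf.
Qed.

Lemma ract_hom (M : right_doi_hopf R) (m : M) :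
  coinvariant (rdh_coact M) m ->
  @right_doi_hopf_hom k H A R (right_regular R) M (ract m).
Proof.
move=> cm; split; first exact: (ract_bilinear M).2.
- by move=> a b; rewrite -ractM.
- have [lM1 lM2] := ract_bilinear M.
  move=> a; rewrite ract_coact cm tlift_tens; last first.
    split=> *; apply: lin_tlift_fun => *; last by lin.
    by apply: lin_tensl.
  by apply: eq_tlift => a0 a1; rewrite mul1r.
Qed.

Lemma lact_hom (M : left_doi_hopf R) (m : M) :
  coinvariant (ldh_coact M) m ->
  @left_doi_hopf_hom k H A R (left_regular R) M (fun a => lact a m).
Proof.
move=> cm; split; first exact: (lact_bilinear M).1.
- by move=> a b; rewrite -lactM.
- have [lM1 lM2] := lact_bilinear M.
  move=> a; rewrite lact_coact cm; apply: eq_tlift => a0 a1.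
  by rewrite tlift_tens ?mulr1 //; lin.
Qed.

(** The regular module is free on the coinvariant generator 1, so isomorphisms
    out of it amount to free coinvariant generators of the target. *)
Lemma right_regular_isoP (M : right_doi_hopf R) :
  right_doi_hopf_iso (right_regular R) M <->
  exists2 m : M, coinvariant (rdh_coact M) m & bijective (ract m).
Proof.
split=> [[f [g [[lf af cf] _ fK gK]]]|[m cm [g fK gK]]].
  exists (f 1).
    by apply: colinear_coinvariant cf _; [|exact: regular_coinvariant1].
  by apply: (eq_bij (Bijective fK gK)) => a; rewrite -af /= mul1r.
exists (ract m), g; have hf := ract_hom cm.
by split=> //; apply: inv_right_doi_hopf_hom hf.
Qed.

Lemma left_regular_isoP (M : left_doi_hopf R) :
  left_doi_hopf_iso (left_regular R) M <->
  exists2 m : M, coinvariant (ldh_coact M) m & bijective (fun a => lact a m).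
Proof.
split=> [[f [g [[lf af cf] _ fK gK]]]|[m cm [g fK gK]]].
  exists (f 1).
    by apply: colinear_coinvariant cf _; [|exact: regular_coinvariant1].
  by apply: (eq_bij (Bijective fK gK)) => a; rewrite -af /= mulr1.
exists (fun a => lact a m), g; have hf := lact_hom cm.
by split=> //; apply: inv_left_doi_hopf_hom hf.
Qed.
End RegularModules.

Section Nondegeneracy.
Variables (k : fieldType) (A : falgType k).

Lemma linear_inj_bij (U V : vectType k) (f0 : U -> V) :
  \dim {:U} = \dim {:V} -> linear f0 -> injective f0 -> bijective f0.
Proof.
move=> dUV lf fI; pose f := HB.pack_for {linear U -> V} f0
  (GRing.isLinear.Build _ _ _ _ _ lf).
have kf : lker (linfun f) == 0%VS.
  by apply/lker0P => x y; rewrite !lfunE => /fI.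
have imf : limg (linfun f) = fullv.
  apply/eqP; rewrite eqEdim subvf -dUV limg_dim_eq //=.
  by rewrite (eqP kf) capv0.
exists (linfun f)^-1%VF => [x|y].
  by rewrite -[f0 x](lfunE f) lker0_lfunK.
by rewrite -[LHS](lfunE f) limg_lfunVK // imf memvf.
Qed.

Lemma dim_dual : \dim {:A} = \dim {:dual A}.
Proof. by rewrite !dimvf /dim /= muln1. Qed.

Lemma dual_separates (a b : A) : (forall f : dual A, f a = f b) -> a = b.
Proof.
move=> fab; rewrite (coord_vbasis (memvf a)) (coord_vbasis (memvf b)).
apply: eq_bigr => i _; congr (_ *: _).
by have := fab (dual_basis i); rewrite !lfunE.
Qed.

(** Surjectivity of a linear map to the dual makes its transpose injective,
    hence bijective since A and its dual have the same dimension. *)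
Lemma dual_ract_lact_bij (l : dual A) :
  bijective (dual_ract l) -> bijective (fun a => dual_lact a l).
Proof.
case=> g _ gK; apply: linear_inj_bij dim_dual _ _.
  exact: (dual_lact_bilinear A).1.
move=> a b /lfunP ab.
apply: dual_separates => h; rewrite -[h]gK !dual_ractE.
by have := ab (g h); rewrite !dual_lactE.
Qed.

Lemma dual_lact_ract_bij (l : dual A) :
  bijective (fun a => dual_lact a l) -> bijective (dual_ract l).
Proof.
case=> g _ gK; apply: linear_inj_bij dim_dual _ _.
  exact: (dual_ract_bilinear A).2.
move=> a b /lfunP ab.
apply: dual_separates => h; rewrite -[h]gK !dual_lactE.
by have := ab (g h); rewrite !dual_ractE.
Qed.
End Nondegeneracy.

Theorem theorem2p5 (k : fieldType) (H : hopfAlgType k) (A : falgType k)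
    (R : comodule_algebra H A) :
  (right_Frobenius R -> left_Frobenius R) /\
  (injective (antipode : H -> H) -> left_Frobenius R -> right_Frobenius R).
Proof.
split=> [/right_regular_isoP [l cl bl]|_ /left_regular_isoP [l cl bl]].
- by apply/left_regular_isoP; exists l; last exact: dual_ract_lact_bij.
- by apply/right_regular_isoP; exists l; last exact: dual_lact_ract_bij.
Qed.
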